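(* Let $\mathcal{H}$ be a separable Hilbert space and let $\mathcal{W},\mathcal{V}$ be closed subspaces of $\mathcal{H}$ with $\mathcal{H}=\mathcal{W}\oplus\mathcal{V}^{\perp}$. Let $\mathcal{F}=\{f_k\}_{k=1}^{\infty}\subset\mathcal{W}$ and $\mathcal{G}=\{g_k\}_{k=1}^{\infty}\subset\mathcal{V}$ be $\epsilon$-approximate oblique dual frames with $0\le\epsilon<1$. For fixed $N\in\mathbb{N}$ let $$\widetilde{g}_k^{(N)}=\sum_{n=0}^{N}\big(\pi_{\mathcal{V}\mathcal{W}^{\perp}}-T_{\mathcal{G}}T_{\mathcal{F}}^{*}\big)^n g_k$$ and $\widetilde{\mathcal{G}}_N=\{\widetilde{g}_k^{(N)}\}_{k=1}^{\infty}$. Then $\widetilde{\mathcal{G}}_N$ is an $\epsilon^{N+1}$-approximate oblique dual frame of $\mathcal{F}$ in $\mathcal{V}$, and $$\big\|\pi_{\mathcal{V}\mathcal{W}^{\perp}}-T_{\widetilde{\mathcal{G}}_N}T_{\mathcal{F}}^{*}\big\|\longrightarrow 0\quad\text{as } N\to\infty.$$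
   Context: The direct sum $\mathcal{H}=\mathcal{W}\oplus\mathcal{V}^{\perp}$ (equivalently $\mathcal{H}=\mathcal{V}\oplus\mathcal{W}^{\perp}$) is not assumed orthogonal. $\pi_{\mathcal{W}\mathcal{V}^{\perp}}$ denotes the oblique projection onto $\mathcal{W}$ along $\mathcal{V}^{\perp}$ (identity on $\mathcal{W}$, zero on $\mathcal{V}^{\perp}$); similarly $\pi_{\mathcal{V}\mathcal{W}^{\perp}}$ is the projection onto $\mathcal{V}$ along $\mathcal{W}^{\perp}$. The zeroth power of an operator is the identity. A sequence $\{f_k\}_{k=1}^{\infty}\subset\mathcal{W}$ is a Bessel sequence for $\mathcal{W}$ if there is $\beta<\infty$ with $\sum_k|\langle f,f_k\rangle|^2\le\beta\|f\|^2$ for all $f\in\mathcal{W}$; it is a frame for $\mathcal{W}$ if moreover $\alpha\|f\|^2\le\sum_{k}|\langle f,f_k\rangle|^2$ for all $f\in\mathcal{W}$ and some $\alpha>0$. For a Bessel sequence $\mathcal{F}=\{f_k\}$, $T_{\mathcal{F}}:\ell^2\to\mathcal{H}$, $T_{\mathcal{F}}\{c_k\}=\sum_k c_kf_k$ is the synthesis operator, with adjoint $T_{\mathcal{F}}^{*}f=\{\langle f,f_k\rangle\}_k$. Frames $\mathcal{F}$ for $\mathcal{W}$ and $\mathcal{G}$ for $\mathcal{V}$ are $\epsilon$-approximate oblique dual frames (and $\mathcal{G}$ is an $\epsilon$-approximate oblique dual frame of $\mathcal{F}$ in $\mathcal{V}$) if $\|\pi_{\mathcal{W}\mathcal{V}^{\perp}}-T_{\mathcal{F}}T_{\mathcal{G}}^{*}\|\le\epsilon$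 or, equivalently, $\|\pi_{\mathcal{V}\mathcal{W}^{\perp}}-T_{\mathcal{G}}T_{\mathcal{F}}^{*}\|\le\epsilon$. *)

(* Defs.v *)
From HB Require Import structures.
From mathcomp Require Export all_boot all_order all_algebra.
From mathcomp Require Export all_classical all_reals all_analysis.
From mathcomp.real_closed Require Export complex.

Set Implicit Arguments.
Unset Strict Implicit.
Unset Printing Implicit Defensive.

Export Order.TTheory GRing.Theory Num.Theory.
Export numFieldNormedType.Exports.
Open Scope classical_set_scope.
Open Scope ring_scope.

Variant scalar_kind := RealScalars | ComplexScalars.

Definition scalar (R : realType) (s : scalar_kind) : numFieldType :=
  match s with RealScalars => R | ComplexScalars => R[i] end.

Definition scalar_conj (R : realType) (s : scalar_kind) : scalar R s -> scalar R s :=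
  match s with RealScalars => id | ComplexScalars => @conjc R end.

Definition scalar_re (R : realType) (s : scalar_kind) : scalar R s -> R :=
  match s with RealScalars => id | ComplexScalars => @complex.Re R end.
Arguments scalar_re {R s}.

(* Norms of normed modules over K take values in K; they are real, and rnorm
   is the same norm with values in R. *)
Definition rnorm (R : realType) (s : scalar_kind) (X : normedZmodType (scalar R s))
    (x : X) : R := scalar_re `|x|.

Definition separable (T : topologicalType) :=
  exists2 A : set T, countable A & dense A.

Section Hilbert.
Variables (R : realType) (s : scalar_kind).
Variable H : completeNormedModType (scalar R s).
(* linear in the first argument, conjugate-linear in the second *)
Variable dot : {dot H for @scalar_conj R s}.

Definition norm_from_dot := forall x : H, `|x| ^+ 2 = dot x x.

Definition closed_linear_subspace (W : set H) :=
  [/\ W 0, forall (a : scalar R s) x y, W x -> W y -> W (a *: x + y) & closed W].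

Definition orthogonal_complement (W : set H) : set H :=
  [set x | forall w, W w -> dot x w = 0].

Definition direct_sum (A B : set H) :=
  (forall x : H, exists a b, [/\ A a, B b & x = a + b]) /\ A `&` B = [set 0].

(* The A-component of x in the decomposition along A and B; it is the oblique
   projection onto A along B when H is the direct sum of A and B. *)
Definition oblique_proj (A B : set H) (x : H) : H :=
  xget 0 [set a | A a /\ B (x - a)].

(* Operator norm, with value +oo on unbounded operators. *)
Definition opnorm (A : H -> H) : \bar R :=
  ereal_sup [set (rnorm (A x))%:E | x in [set x : H | `|x| <= 1]].

Definition coef_energy (F : nat -> H) (x : H) : \bar R :=
  (\sum_(0 <= k <oo) ((rnorm (dot x (F k) : scalar R s)) ^+ 2)%:E)%E.

Definition bessel_seq (W : set H) (F : nat -> H) :=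
  (forall k, W (F k)) /\
  exists beta : R, forall x, W x -> (coef_energy F x <= (beta * rnorm x ^+ 2)%:E)%E.

Definition frame (W : set H) (F : nat -> H) :=
  bessel_seq W F /\
  exists2 alpha : R, 0 < alpha &
    forall x, W x -> ((alpha * rnorm x ^+ 2)%:E <= coef_energy F x)%E.

(* T_F, meaningful on square-summable c when F is Bessel *)
Definition synthesis (F : nat -> H) (c : nat -> scalar R s) : H :=
  limn (series (fun k => c k *: F k)).

(* T_F^* *)
Definition analysis (F : nat -> H) (x : H) : nat -> scalar R s :=
  fun k => dot x (F k).

(* pi_{V W^perp} - T_G T_F^* *)
Definition dual_defect (V W : set H) (G F : nat -> H) (x : H) : H :=
  oblique_proj V (orthogonal_complement W) x - synthesis G (analysis F x).

Definition approx_oblique_dual (eps : R) (W V : set H) (F G : nat -> H) :=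
  [/\ frame W F, frame V G & (opnorm (dual_defect W V F G) <= eps%:E)%E].

Definition iterated_dual (V W : set H) (F G : nat -> H) (N : nat) : nat -> H :=
  fun k => \sum_(0 <= n < N.+1) iter n (dual_defect V W G F) (G k).

End Hilbert.

(* Main.v *)
(* Write D for the defect [pi_{V W^perp} - T_G T_F^*] and D' for
   [pi_{W V^perp} - T_F T_G^*]. Since [T_F T_G^*] and D' are bounded, so is
   [P = pi_{W V^perp}], without the closed graph theorem. From
   [<v, P v> = |v|^2] on V one gets [|v| <= |P| |v + u|] for v in V and u in
   W^perp, so [V + W^perp] is closed; its complement is [V^perp /\ W = 0],
   hence [H = V (+) W^perp]. Then D is adjoint to D', so [|D| <= eps].
   Both [D] and [T_G T_F^*] vanish on W^perp, so [D pi = D], and the sum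
   [(1 + D + ... + D^N) (pi - D)], which is the mixed operator of the iterated
   family, telescopes to [pi - D^(N+1)]: the new defect is [D^(N+1)]. *)

Require Import Defs.
From mathcomp Require Import ring lra.

Set Implicit Arguments.
Unset Strict Implicit.
Unset Printing Implicit Defensive.

(** * Scalars and real-valued norms *)

Section Scalars.
Variables (R : realType) (s : scalar_kind).
Implicit Types (z w : scalar R s) (x y : R).

(** Inverse of [scalar_re] on nonnegative scalars; it carries order statements about norms from
    [scalar R s] to [R]. *)
Definition scalar_of_real : R -> scalar R s :=
  match s return R -> scalar R s with
  | RealScalars => id | ComplexScalars => fun x => (x%:C)%C end.

Lemma scalar_reD : {morph @scalar_re R s : z w / z + w}.
Proof. by case: s => //= -[a b] [c d]. Qed.

Lemma scalar_re0 : @scalar_re R s 0 = 0.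
Proof. by case: s. Qed.

Lemma scalar_reN : {morph @scalar_re R s : z / - z}.
Proof. by case: s => //= -[a b]. Qed.

Lemma scalar_conj0 : @scalar_conj R s 0 = 0.
Proof. by case: s => //=; exact: conjc0. Qed.

Lemma scalar_conjK : involutive (@scalar_conj R s).
Proof. by case: s => //=; exact: conjcK. Qed.

Lemma scalar_re_conj z : scalar_re (scalar_conj z) = scalar_re z.
Proof. by move: z; case: s => //= -[a b]. Qed.

Lemma scalar_of_realK : cancel scalar_of_real scalar_re.
Proof. by rewrite /scalar_of_real; case: s. Qed.

Lemma scalar_reK z : 0 <= z -> scalar_of_real (scalar_re z) = z.
Proof.
by move: z; rewrite /scalar_of_real; case: s => //= -[a b] /ger0_Im /= ->.
Qed.

Lemma scalar_of_real_le x y : (scalar_of_real x <= scalar_of_real y) = (x <= y).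
Proof. by rewrite /scalar_of_real; case: s => //=; exact: lecR. Qed.

Lemma scalar_of_real_lt x y : (scalar_of_real x < scalar_of_real y) = (x < y).
Proof. by rewrite /scalar_of_real; case: s => //=; exact: ltcR. Qed.

Lemma scalar_of_real0 : scalar_of_real 0 = 0.
Proof. by rewrite /scalar_of_real; case: s. Qed.

Lemma scalar_re_gt0 z : 0 < z -> 0 < scalar_re z.
Proof.
by move=> z0; rewrite -scalar_of_real_lt scalar_of_real0 scalar_reK// ltW.
Qed.

Lemma scalar_of_real1 : scalar_of_real 1 = 1.
Proof. by rewrite /scalar_of_real; case: s. Qed.

Lemma scalar_conj_of_real x : scalar_conj (scalar_of_real x) = scalar_of_real x.
Proof. by rewrite /scalar_of_real; case: s => //=; exact: conjc_real. Qed.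

Lemma scalar_re_le z w : z <= w -> scalar_re z <= scalar_re w.
Proof. by move: z w; case: s => //= z w; rewrite lecE => /andP[]. Qed.

Lemma scalar_re_ofM x z :
  scalar_re (scalar_of_real x * z) = x * scalar_re z.
Proof.
by move: z; rewrite /scalar_of_real; case: s => //= -[a b] /=;
  rewrite mul0r subr0.
Qed.

Lemma scalar_re_geM z w : 0 <= z ->
  scalar_re (z * w) = scalar_re z * scalar_re w.
Proof. by move=> z0; rewrite -{1}(scalar_reK z0) scalar_re_ofM. Qed.

Lemma scalar_re_mul_conj z : scalar_re (z * scalar_conj z) = rnorm z ^+ 2.
Proof.
rewrite /rnorm [RHS]expr2 -scalar_re_geM// -expr2; congr scalar_re.
move: z; case: s => //= z; last by rewrite sqr_normc.
by rewrite real_normK ?num_real// expr2.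
Qed.

Lemma rnorm_conj z : rnorm (scalar_conj z) = rnorm z.
Proof.
by rewrite /rnorm; congr scalar_re; move: z; case: s => //= z; rewrite normcJ.
Qed.

Lemma scalar_re_le_rnorm z : scalar_re z <= rnorm z.
Proof.
rewrite /rnorm; move: z; case: s => /= z; first exact: ler_norm.
have := normc_ge_Re z; rewrite lecE => /andP[_] /=.
by apply: le_trans; exact: ler_norm.
Qed.

Lemma rnormM z w : rnorm (z * w) = rnorm z * rnorm w.
Proof. by rewrite /rnorm normrM scalar_re_geM. Qed.

End Scalars.

Section RealNorm.
Variables (R : realType) (s : scalar_kind) (X : normedZmodType (scalar R s)).
Implicit Types x y : X.

Lemma rnormE x : `|x| = scalar_of_real s (rnorm x).
Proof. by rewrite scalar_reK. Qed.

Lemma rnorm_ge0 x : 0 <= rnorm x.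
Proof. by rewrite -(scalar_re0 R s); apply: scalar_re_le. Qed.

Lemma rnorm0 : rnorm (0 : X) = 0.
Proof. by rewrite /rnorm normr0 scalar_re0. Qed.

Lemma rnorm_eq0 x : rnorm x = 0 -> x = 0.
Proof.
by move=> x0; apply/eqP; rewrite -normr_eq0 rnormE x0 scalar_of_real0.
Qed.

Lemma rnormN x : rnorm (- x) = rnorm x.
Proof. by rewrite /rnorm normrN. Qed.

Lemma rnormD x y : rnorm (x + y) <= rnorm x + rnorm y.
Proof. by rewrite /rnorm -scalar_reD; apply: scalar_re_le; exact: ler_normD. Qed.

Lemma rnormB x y : rnorm (x - y) = rnorm (y - x).
Proof. by rewrite -rnormN opprB. Qed.

Lemma ler_rnorm x (r : R) : (`|x| <= scalar_of_real s r) = (rnorm x <= r).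
Proof. by rewrite rnormE scalar_of_real_le. Qed.

Lemma rnorm_le_eps x : (forall e : R, 0 < e -> rnorm x <= e) -> x = 0.
Proof.
move=> h; apply: rnorm_eq0; apply/eqP; rewrite eq_le rnorm_ge0 andbT.
by apply/ler_addgt0Pl => e e0; rewrite addr0 h.
Qed.

End RealNorm.

Lemma rnormZ (R : realType) (s : scalar_kind) (X : normedModType (scalar R s))
  (a : scalar R s) (x : X) : rnorm (a *: x) = rnorm a * rnorm x.
Proof. by rewrite /rnorm normrZ scalar_re_geM. Qed.

(** * Convergence and completeness through real-valued norms *)

Section Convergence.
Variables (R : realType) (s : scalar_kind).

(** A positive element of [scalar R s] is real even for complex scalars, so tolerances may range
    over [R]. *)
Lemma cvg_rnormP (X : normedModType (scalar R s)) (u : nat -> X) (l : X) :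
  (u @ \oo --> l) <->
  (forall e : R, 0 < e -> \forall n \near \oo, rnorm (u n - l) <= e).
Proof.
split=> [/cvgrPdist_le ul e e0|h].
  have e0' : 0 < scalar_of_real s e.
    by rewrite -(scalar_of_real0 R s) scalar_of_real_lt.
  have := ul _ e0'; apply: filterS => n.
  by rewrite ler_rnorm rnormB.
apply/cvgrPdist_le => e e0.
have er := scalar_reK (ltW e0).
have /h := scalar_re_gt0 e0; apply: filterS => n hn.
by rewrite -er ler_rnorm rnormB.
Qed.

Definition rcauchy (X : normedZmodType (scalar R s)) (u : nat -> X) :=
  forall e : R, 0 < e ->
    exists N, forall m n, (N <= m)%N -> (N <= n)%N -> rnorm (u m - u n) <= e.

Lemma rcauchy_cvg (X : completeNormedModType (scalar R s)) (u : nat -> X) :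
  rcauchy u -> cvgn u.
Proof.
move=> cu; apply/cauchy_cvgP; apply/cauchy_ballP => e e0.
have er := scalar_reK (ltW e0).
have re0 := scalar_re_gt0 e0.
have [N hN] := cu _ (divr_gt0 re0 (ltr0Sn R 1)).
exists (u @` [set n | (N <= n)%N], u @` [set n | (N <= n)%N]) => /=.
  by split; exists N => // n /= Nn; exists n.
move=> [_ _] /= [[m Nm <-] [n Nn <-]]; rewrite -ball_normE /=.
apply: (@le_lt_trans _ _ (scalar_of_real s (scalar_re e / 2))).
  by rewrite ler_rnorm; exact: hN.
by rewrite -[in ltRHS]er scalar_of_real_lt ltr_pdivrMr// ltr_pMr// ltr1n.
Qed.

(** Used in place of closedness because for the sum of [V] and [W^perp] it can be checked directly
    on Cauchy sequences. *)
Definition seq_complete (X : normedModType (scalar R s)) (Z : set X) :=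
  forall u : nat -> X, (forall n, Z (u n)) -> rcauchy u ->
    exists2 l, Z l & u @ \oo --> l.

Lemma closed_seq_complete (X : completeNormedModType (scalar R s)) (Z : set X) :
  closed Z -> seq_complete Z.
Proof.
move=> cZ u Zu /rcauchy_cvg cu; exists (limn u) => //.
by apply: (closed_cvg Z) cu => //; apply: nearW.
Qed.

Lemma cvg_rnorm_le (X : normedModType (scalar R s)) (u : nat -> X) (l : X) (M : R) :
  (\forall n \near \oo, rnorm (u n) <= M) -> u @ \oo --> l -> rnorm l <= M.
Proof.
move=> uM /cvg_rnormP ul; apply/ler_addgt0Pl => e /ul ule.
have [n [un /= une]] := filter_ex (filterI uM ule).
rewrite -(subrK (u n) l) (le_trans (rnormD _ _))// lerD//.
by rewrite rnormB.
Qed.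

End Convergence.

(** * The inner product and orthogonal decomposition *)

Section InnerProduct.
Variables (R : realType) (s : scalar_kind).
Variable H : completeNormedModType (scalar R s).
Variable dot : {dot H for @scalar_conj R s}.
Hypothesis dot_norm : norm_from_dot dot.
Implicit Types (x y z : H) (a : scalar R s) (t : R).

Local Notation re_dot x y := (scalar_re (dot x y : scalar R s)).

Lemma dotC x y : dot x y = scalar_conj (dot y x).
Proof. by rewrite (@hermitian_subproof _ _ _ _ dot x y) expr0 mul1r. Qed.

Lemma dotDl x y z : dot (x + y) z = dot x z + dot y z.
Proof. exact: linearDl. Qed.

Lemma dotBl x y z : dot (x - y) z = dot x z - dot y z.
Proof. exact: linearBl. Qed.

Lemma dotDr x y z : dot x (y + z) = dot x y + dot x z.
Proof. exact: linearDr. Qed.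

Lemma dotBr x y z : dot x (y - z) = dot x y - dot x z.
Proof. exact: linearBr. Qed.

Lemma dotNr x y : dot x (- y) = - dot x y.
Proof. exact: linearNr. Qed.

Lemma dot0l x : dot 0 x = 0.
Proof. exact: linear0l. Qed.

Lemma dot0r x : dot x 0 = 0.
Proof. exact: linear0r. Qed.

Lemma dotZl a x y : dot (a *: x) y = a * dot x y.
Proof. exact: (@linearl_subproof _ _ _ _ _ _ dot y a x). Qed.

Lemma dotZr a x y : dot x (a *: y) = scalar_conj a * dot x y.
Proof. exact: (@linearr_subproof _ _ _ _ _ _ dot x a y). Qed.

Lemma dot_suml I (r : seq I) (P : pred I) (F : I -> H) y :
  dot (\sum_(i <- r | P i) F i) y = \sum_(i <- r | P i) dot (F i) y.
Proof. by apply: (big_morph (fun x => dot x y)) => [? ?|]; [exact: dotDl|exact: dot0l]. Qed.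

Lemma dot_sumr I (r : seq I) (P : pred I) (F : I -> H) x :
  dot x (\sum_(i <- r | P i) F i) = \sum_(i <- r | P i) dot x (F i).
Proof. by apply: (big_morph (dot x)) => [? ?|]; [exact: dotDr|exact: dot0r]. Qed.

Lemma rnorm_dotC x y : rnorm (dot x y : scalar R s) = rnorm (dot y x : scalar R s).
Proof. by rewrite dotC rnorm_conj. Qed.

Lemma re_dotC x y : re_dot x y = re_dot y x.
Proof. by rewrite dotC scalar_re_conj. Qed.

Lemma re_dotxx x : re_dot x x = rnorm x ^+ 2.
Proof. by rewrite -dot_norm !expr2 scalar_re_geM. Qed.

Lemma rnorm_sqrD x y : rnorm (x + y) ^+ 2 =
  rnorm x ^+ 2 + 2 * re_dot x y + rnorm y ^+ 2.
Proof.
rewrite -!re_dotxx dotDl !dotDr !scalar_reD (re_dotC y x) mulr2n mulrDl mul1r.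
by rewrite !addrA.
Qed.

Lemma rnorm_sqrB_scale x y t : rnorm (x - scalar_of_real s t *: y) ^+ 2 =
  rnorm x ^+ 2 - 2 * t * re_dot x y + t ^+ 2 * rnorm y ^+ 2.
Proof.
rewrite rnorm_sqrD rnormN dotNr scalar_reN dotZr scalar_conj_of_real.
rewrite scalar_re_ofM rnormZ exprMn.
rewrite -[rnorm (scalar_of_real s t) ^+ 2]scalar_re_mul_conj scalar_conj_of_real.
by rewrite scalar_re_ofM scalar_of_realK; ring.
Qed.

Lemma re_dot_le x y : re_dot x y <= rnorm x * rnorm y.
Proof.
have [y0|y0] := eqVneq (rnorm y) 0.
  by rewrite (rnorm_eq0 y0) dot0r scalar_re0 rnorm0 mulr0.
have yp : 0 < rnorm y by rewrite lt_neqAle eq_sym y0 rnorm_ge0.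
have [x0|x0] := eqVneq (rnorm x) 0.
  by rewrite (rnorm_eq0 x0) dot0l scalar_re0 rnorm0 mul0r.
have xp : 0 < rnorm x by rewrite lt_neqAle eq_sym x0 rnorm_ge0.
(* With this [q] both square terms of [|x - q y|^2] equal [q^2 |y|^2], so its nonnegativity is the
   claim multiplied by [2 q]. *)
pose q := rnorm x / rnorm y.
have xE : rnorm x = q * rnorm y by rewrite /q divfK.
have qp : 0 < q by exact: divr_gt0.
have := sqr_ge0 (rnorm (x - scalar_of_real s q *: y)).
rewrite rnorm_sqrB_scale xE => h; rewrite -(ler_pM2l qp).
by move: (scalar_re _) h => c; lra.
Qed.

(** Multiplying [x] by the conjugate of [z = <x, y>] makes the product the real number [|z|^2],
    which reduces the claim to [re_dot_le]. *)
Lemma rnorm_dot_le x y : rnorm (dot x y : scalar R s) <= rnorm x * rnorm y.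
Proof.
set z : scalar R s := dot x y.
have [z0|z0] := eqVneq (rnorm z) 0; first by rewrite z0 mulr_ge0 ?rnorm_ge0.
have zp : 0 < rnorm z by rewrite lt_neqAle eq_sym z0 rnorm_ge0.
rewrite -(ler_pM2l zp) -expr2 -scalar_re_mul_conj mulrC -dotZl.
by rewrite (le_trans (re_dot_le _ _))// rnormZ rnorm_conj mulrA.
Qed.

Lemma dot_eq0 x y : (forall a, re_dot (a *: x) y = 0) -> dot x y = 0.
Proof.
move=> /(_ (scalar_conj (dot x y))); rewrite dotZl mulrC scalar_re_mul_conj.
by move=> /eqP; rewrite expf_eq0 /= => /eqP/rnorm_eq0.
Qed.

(** Joint continuity of the inner product, in the form that passes adjointness of partial sums to
    their limits. *)
Lemma dot_cvg_adjoint (u v : nat -> H) x y (a b : H) :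
  u @ \oo --> a -> v @ \oo --> b -> (forall n, dot (u n) y = dot x (v n)) ->
  dot a y = dot x b.
Proof.
move=> /cvg_rnormP ua /cvg_rnormP vb uv; apply/eqP; rewrite -subr_eq0; apply/eqP.
apply: rnorm_le_eps => e e0.
(* The summand 1 keeps the divisor positive when [x] and [y] both vanish. *)
have Mp : 0 < rnorm x + rnorm y + 1 by rewrite ltr_wpDl ?addr_ge0 ?rnorm_ge0.
have dp := divr_gt0 e0 Mp.
have [n [un vn]] : exists n, rnorm (u n - a) <= e / (rnorm x + rnorm y + 1) /\
    rnorm (v n - b) <= e / (rnorm x + rnorm y + 1).
  by near \oo => n; exists n; split; near: n; [exact: ua|exact: vb].
have -> : dot a y - dot x b = dot (a - u n) y + dot x (v n - b).
  by rewrite dotBl dotBr uv addrA subrK.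
rewrite (le_trans (rnormD _ _))//.
apply: (@le_trans _ _ (e / (rnorm x + rnorm y + 1) * (rnorm x + rnorm y))).
  rewrite mulrDr addrC lerD// (le_trans (rnorm_dot_le _ _))//.
    by rewrite mulrC ler_wpM2r ?rnorm_ge0.
  by rewrite ler_wpM2r ?rnorm_ge0// rnormB.
by rewrite mulrAC ler_pdivrMr// ler_pM2l// lerDl.
Unshelve. all: by end_near. Qed.

Lemma dot_seq_cvgl (u : nat -> H) y (a : H) :
  u @ \oo --> a -> (forall n, dot (u n) y = 0) -> dot a y = 0.
Proof.
move=> ua u0; rewrite -(dot0l 0).
by apply: (dot_cvg_adjoint ua (cvg_cst 0)) => n; rewrite u0 dot0l.
Qed.

End InnerProduct.

Definition linear_subspace (R : realType) (s : scalar_kind)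
    (H : completeNormedModType (scalar R s)) (Z : set H) :=
  Z 0 /\ forall (a : scalar R s) x y, Z x -> Z y -> Z (a *: x + y).

Section LinearSubspace.
Variables (R : realType) (s : scalar_kind).
Variable H : completeNormedModType (scalar R s).
Variables (Z : set H) (lZ : linear_subspace Z).

Lemma subspaceZ a x : Z x -> Z (a *: x).
Proof. by move=> Zx; rewrite -[_ *: _]addr0; apply: lZ.2 => //; exact: lZ.1. Qed.

Lemma subspaceD x y : Z x -> Z y -> Z (x + y).
Proof. by move=> Zx Zy; rewrite -(scale1r x); exact: lZ.2. Qed.

Lemma subspaceB x y : Z x -> Z y -> Z (x - y).
Proof. by move=> Zx Zy; rewrite addrC -scaleN1r; exact: lZ.2. Qed.

Lemma subspace_sum I (r : seq I) (P : pred I) (F : I -> H) :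
  (forall i, P i -> Z (F i)) -> Z (\sum_(i <- r | P i) F i).
Proof. by apply: (big_ind Z) => [|x y]; [exact: lZ.1|exact: subspaceD]. Qed.

End LinearSubspace.

Lemma ler_of_sqr_le (R : realType) (t M : R) : 0 <= M -> t ^+ 2 <= M ^+ 2 -> t <= M.
Proof.
move=> M0 tM; have [t0|/ltW t0] := leP 0 t; last exact: le_trans M0.
by rewrite -(ler_pXn2r (ltn0Sn 1)).
Qed.

(** * The orthogonal projection theorem *)

Section Projection.
Variables (R : realType) (s : scalar_kind).
Variable H : completeNormedModType (scalar R s).
Variable dot : {dot H for @scalar_conj R s}.
Hypothesis dot_norm : norm_from_dot dot.
Variables (Z : set H) (lZ : linear_subspace Z) (cZ : seq_complete Z).

Lemma parallelogram (x y : H) : rnorm (x + y) ^+ 2 + rnorm (x - y) ^+ 2 =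
  2 * rnorm x ^+ 2 + 2 * rnorm y ^+ 2.
Proof.
by rewrite !(rnorm_sqrD dot_norm) rnormN dotNr scalar_reN; ring.
Qed.

(** The midpoint of [u m] and [u n] lies in [Z], hence at squared distance at least [d] from [x];
    the parallelogram law then leaves [|u m - u n|^2 <= 2 (1/(m+1) + 1/(n+1))]. *)
Lemma min_seq_rcauchy (x : H) (d : R) (u : nat -> H) :
  (forall z, Z z -> d <= rnorm (x - z) ^+ 2) -> (forall n, Z (u n)) ->
  (forall n, rnorm (x - u n) ^+ 2 <= d + n.+1%:R^-1) -> rcauchy u.
Proof.
move=> dP Zu ud e e0.
have [N _ hN] : \forall n \near \oo, (n.+1%:R^-1 : R) <= e ^+ 2 / 4.
  have e4 : 0 < e ^+ 2 / 4 by rewrite divr_gt0// exprn_gt0.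
  by have := near_infty_natSinv_lt (PosNum e4); apply: filterS => n /ltW.
exists N => m n /hN/= mN /hN/= nN.
apply: ler_of_sqr_le; first exact: ltW.
have mid : Z (2^-1 *: (u m + u n)).
  by apply: subspaceZ => //; exact: subspaceD.
have := parallelogram (x - u n) (x - u m).
have -> : x - u n - (x - u m) = u m - u n by rewrite opprB addrC subrKA.
have -> : x - u n + (x - u m) = 2 *: (x - 2^-1 *: (u m + u n)).
  rewrite scalerBr scalerA mulfV ?pnatr_eq0// scale1r opprD.
  by rewrite -[2]/(1 + 1) scalerDl scale1r addrACA (addrC (- u n)).
rewrite rnormZ exprMn.
have -> : rnorm (2 : scalar R s) = 2 :> R.
  by rewrite /rnorm ger0_norm// /scalar_re; case: (s).
have := dP _ mid; have := ud m; have := ud n.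
set A := rnorm (x - u n) ^+ 2; set B := rnorm (x - u m) ^+ 2.
set C := rnorm (x - _) ^+ 2; set E := rnorm _ ^+ 2.
by move: mN nN; move: m.+1%:R^-1 n.+1%:R^-1 => p q hp hq hm hn hC hE; lra.
Qed.

(** A minimizing sequence for the distance from [x] to [Z] converges in [Z], and a first-order
    variation at the minimizer gives orthogonality. *)
Lemma orthogonal_decomposition (x : H) :
  exists2 z, Z z & orthogonal_complement dot Z (x - z).
Proof.
pose E : set R := [set rnorm (x - z) ^+ 2 | z in Z].
have lbE : has_lbound E by exists 0 => _ [z _ <-]; exact: sqr_ge0.
have E0 : E !=set0 by exists (rnorm (x - 0) ^+ 2); exists 0 => //; exact: lZ.1.
pose d := inf E.
have dP z : Z z -> d <= rnorm (x - z) ^+ 2.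
  by move=> Zz; apply: ge_inf => //; exists z.
have ex n : exists z, Z z /\ rnorm (x - z) ^+ 2 <= d + n.+1%:R^-1.
  have [] := @inf_adherent _ E n.+1%:R^-1 _ (conj E0 lbE).
    by rewrite invr_gt0.
  by move=> _ [z Zz <-] /ltW ?; exists z.
have [u uP] := choice ex.
have Zu n : Z (u n) := (uP n).1.
have ud n := (uP n).2.
have [z Zz uz] := cZ Zu (min_seq_rcauchy dP Zu ud).
have xuz : (fun n => x - u n) @ \oo --> x - z.
  by apply: cvgB => //; exact: cvg_cst.
have xzd : rnorm (x - z) ^+ 2 <= d.
  apply/ler_addgt0Pr => e e0.
  have d0 : 0 <= d by apply: lb_le_inf => // _ [? _ <-]; exact: sqr_ge0.
  have de0 : 0 <= d + e by rewrite addr_ge0// ltW.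
  rewrite -(sqr_sqrtr de0) ler_pXn2r ?nnegrE ?sqrtr_ge0 ?rnorm_ge0//.
  apply: cvg_rnorm_le xuz.
  have := near_infty_natSinv_lt (PosNum e0); apply: filterS => n /= ne.
  apply: ler_of_sqr_le; rewrite ?sqrtr_ge0// sqr_sqrtr//.
  by rewrite (le_trans (ud n))// lerD2l ltW.
have re0 : forall w, Z w -> scalar_re (dot (x - z) w : scalar R s) = 0.
  move=> w Zw; set r := scalar_re _; set q := rnorm w ^+ 2.
  have q0 : 0 <= q by exact: sqr_ge0.
  have q1 : 0 < q + 1 by rewrite ltr_wpDl.
  (* The optimal step would be [r / q]; adding 1 covers [w = 0]. Minimality gives
     [0 <= - 2 t r + t^2 q], which with [r = t (q + 1)] is [t^2 (q + 2) <= 0]. *)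
  pose t := r / (q + 1).
  have := dP _ (subspaceD lZ Zz (subspaceZ lZ (scalar_of_real s t) Zw)).
  rewrite opprD addrA (rnorm_sqrB_scale dot_norm) -/r -/q => /(le_trans xzd).
  rewrite -addrA lerDl => h.
  have rt : r = t * (q + 1) by rewrite /t mulfVK ?gt_eqF.
  suff t0 : t = 0 by rewrite rt t0 mul0r.
  apply/eqP; rewrite -sqrf_eq0; apply/eqP/le_anti; rewrite sqr_ge0 andbT.
  move: h; rewrite rt; nra.
(* Vanishing real parts suffice: a scalar on the left argument moves, conjugated, onto [w], which
   stays in [Z]. *)
exists z => // w Zw; apply: dot_eq0 => a.
rewrite dotZl -(scalar_conjK a) -dotZr re0//.
exact: subspaceZ.
Qed.

End Projection.

(** * Bessel sequences and synthesis *)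

Section LinearLimit.
Variables (R : realType) (s : scalar_kind).
Variable H : completeNormedModType (scalar R s).

Lemma linear_limit (T : nat -> H -> H) (L : H -> H) :
  (forall n, linear (T n)) -> (forall x, T n x @[n --> \oo] --> L x) -> linear L.
Proof.
move=> lT TL a x y; apply: (cvg_unique (@norm_hausdorff _ H) (TL _)).
rewrite (_ : (fun n => _) = fun n => a *: T n x + T n y).
  by apply: cvgD => //; apply: cvgZr.
by apply/funext => n; rewrite lT.
Qed.

End LinearLimit.

Lemma sum_nat_split (V : zmodType) (f : nat -> V) (m n : nat) : (m <= n)%N ->
  \sum_(0 <= k < n) f k = \sum_(0 <= k < m) f k + \sum_(m <= k < n) f k.
Proof. by move=> mn; rewrite -big_cat_nat. Qed.

Section Bessel.
Variables (R : realType) (s : scalar_kind).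
Variable H : completeNormedModType (scalar R s).
Variable dot : {dot H for @scalar_conj R s}.
Hypothesis dot_norm : norm_from_dot dot.
Implicit Types (x y z : H) (F G : nat -> H) (c : nat -> scalar R s) (B M : R).

(** Unlike [bessel_seq], it ranges over the whole space and uses finite sums, so that all estimates
    stay in [R]. *)
Definition bessel_bound F B :=
  forall x n, \sum_(0 <= k < n) rnorm (dot x (F k) : scalar R s) ^+ 2
              <= B * rnorm x ^+ 2.

Lemma coef_energy_leP F x M : (coef_energy dot F x <= M%:E)%E <->
  (forall n, \sum_(0 <= k < n) rnorm (dot x (F k) : scalar R s) ^+ 2 <= M).
Proof.
have pos : forall k, (0 <= k)%N -> true ->
    (0 <= (rnorm (dot x (F k) : scalar R s) ^+ 2)%:E)%E.
  by move=> k _ _; rewrite lee_fin sqr_ge0.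
split=> [FM n|FM].
  rewrite -lee_fin -sumEFin; apply: le_trans FM.
  by apply: nneseries_lim_ge => k *; exact: pos.
apply: lime_le; first by apply: is_cvg_nneseries => k *; exact: pos.
by apply: nearW => n; rewrite sumEFin lee_fin.
Qed.

(** An infinite energy makes the claim trivial; a finite one is itself an upper bound of the partial
    sums. *)
Lemma le_coef_energy F x M :
  (forall M', (forall n, \sum_(0 <= k < n) rnorm (dot x (F k) : scalar R s) ^+ 2
                         <= M') -> M <= M') ->
  (M%:E <= coef_energy dot F x)%E.
Proof.
move=> h; have := coef_energy_leP F x.
have : (0 <= coef_energy dot F x)%E.
  by apply: nneseries_ge0 => k _ _; rewrite lee_fin sqr_ge0.
case: (coef_energy dot F x) => [e| |] //= _ FM; last by rewrite leey.
by rewrite lee_fin; apply: h; apply/FM.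
Qed.

(** The coefficients of [x] are those of its orthogonal projection [w] on [W], and [|w| <= |x|]. *)
Lemma bessel_seq_bound W F : closed_linear_subspace W -> bessel_seq dot W F ->
  exists2 B, 0 < B & bessel_bound F B.
Proof.
move=> [W0 lW cW] [FW [b Fb]].
(* The given constant [b] may be nonpositive; the maximum with 1 makes later divisions
   legitimate. *)
exists (Num.max b 1) => [|x n]; first by rewrite lt_max ltr01 orbT.
have [w Ww xw] := orthogonal_decomposition dot_norm (conj W0 lW)
  (closed_seq_complete cW) x.
have -> : \sum_(0 <= k < n) rnorm (dot x (F k) : scalar R s) ^+ 2 =
          \sum_(0 <= k < n) rnorm (dot w (F k) : scalar R s) ^+ 2.
  apply: eq_bigr => k _; congr (rnorm _ ^+ 2).
  by apply/eqP; rewrite -subr_eq0 -dotBl xw.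
rewrite (le_trans ((coef_energy_leP F w _).1 (Fb w Ww) n))//.
apply: (@le_trans _ _ (Num.max b 1 * rnorm w ^+ 2)).
  by rewrite ler_wpM2r ?sqr_ge0// le_max lexx.
rewrite ler_wpM2l ?le_max ?ler01 ?orbT//.
rewrite -[in leRHS](subrK w x) addrC (rnorm_sqrD dot_norm) re_dotC xw// scalar_re0.
by rewrite mulr0 addr0 lerDl sqr_ge0.
Qed.

(** Expand [|y|^2] as the sum of the real parts of [c_k <F_k, y>] and bound each term by Young's
    inequality with weight [B]. The Bessel bound makes the part involving [y] at most [|y|^2 / 2],
    which the left side absorbs. *)
Lemma bessel_partial F B c m n : 0 < B -> bessel_bound F B ->
  rnorm (\sum_(m <= k < n) c k *: F k) ^+ 2
    <= B * \sum_(m <= k < n) rnorm (c k) ^+ 2.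
Proof.
move=> B0 FB; set y := \sum_(m <= k < n) _.
have : rnorm y ^+ 2 <= \sum_(m <= k < n)
    (B * rnorm (c k) ^+ 2 + rnorm (dot y (F k) : scalar R s) ^+ 2 / B) / 2.
  rewrite -(re_dotxx dot_norm) {1}/y dot_suml.
  rewrite (big_morph _ (@scalar_reD R s) (scalar_re0 R s)).
  apply: ler_sum => k _; rewrite dotZl.
  rewrite (le_trans (scalar_re_le_rnorm _))// rnormM rnorm_dotC.
  set p := rnorm _; set q := rnorm _.
  have B1 : B != 0 by rewrite gt_eqF.
  have -> : q ^+ 2 / B = B * (q / B) ^+ 2 by field.
  have -> : p * q = B * (p * (q / B)) by field.
  have := sqr_ge0 (p - q / B); rewrite -(pmulr_rge0 _ B0).
  by move: (q / B) => r; lra.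
rewrite -mulr_suml big_split/= -mulr_sumr -mulr_suml => h.
have : \sum_(m <= k < n) rnorm (dot y (F k) : scalar R s) ^+ 2 <= B * rnorm y ^+ 2.
  apply: le_trans (FB y n).
  have [mn|nm] := leqP m n; last first.
    rewrite big_geq; last exact: ltnW.
    by apply: sumr_ge0 => k _; exact: sqr_ge0.
  rewrite (sum_nat_split _ mn) lerDr; apply: sumr_ge0 => k _; exact: sqr_ge0.
by rewrite mulrC -ler_pdivrMr//; lra.
Qed.

(** By [bessel_partial] the blocks of the series are controlled by the blocks of the convergent
    series of [|c_k|^2]. *)
Lemma bessel_series_cvg F B c M : 0 < B -> bessel_bound F B ->
  (forall n, \sum_(0 <= k < n) rnorm (c k) ^+ 2 <= M) ->
  series (fun k => c k *: F k) @ \oo --> synthesis F c.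
Proof.
move=> B0 FB cM.
pose E n := \sum_(0 <= k < n) rnorm (c k) ^+ 2.
have cE : cvgn E.
  apply: nondecreasing_is_cvgn; last by exists M => _ [n _ <-]; exact: cM.
  apply/nondecreasing_seqP => n; rewrite /E big_nat_recr//= lerDl; exact: sqr_ge0.
suff : rcauchy (series (fun k => c k *: F k)) by move/rcauchy_cvg.
have key (e : R) : 0 < e -> exists N, forall m n, (N <= m <= n)%N ->
    rnorm (\sum_(m <= k < n) c k *: F k) <= e.
  (* Halved because [E m] and [E n] are compared through their limit; their difference is then at
     most [e^2 / B]. *)
  move=> e0; have d0 : 0 < e ^+ 2 / B / 2 by rewrite !divr_gt0// exprn_gt0.
  have [N _ hN] := proj1 (cvgrPdist_le _ _) cE _ d0.
  exists N => m n /andP[Nm mn]; apply: ler_of_sqr_le; first exact: ltW.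
  rewrite (le_trans (bessel_partial c m n B0 FB))// mulrC -ler_pdivlMr//.
  have -> : \sum_(m <= k < n) rnorm (c k) ^+ 2 = E n - E m.
    by rewrite /E (sum_nat_split _ mn) addrAC subrr add0r.
  have := hN n (leq_trans Nm mn); have := hN m Nm => /=.
  rewrite !ler_norml; lra.
move=> e e0; have [N hN] := key e e0; exists N => m n Nm Nn.
rewrite /series/=; have [mn|/ltnW nm] := leqP m n.
  rewrite rnormB (sum_nat_split _ mn) addrAC subrr add0r.
  by rewrite hN// Nm.
rewrite (sum_nat_split _ nm) addrAC subrr add0r.
by rewrite hN// Nn.
Qed.

Lemma rnorm_synthesis F B c M : 0 < B -> bessel_bound F B ->
  (forall n, \sum_(0 <= k < n) rnorm (c k) ^+ 2 <= M) ->
  rnorm (synthesis F c) ^+ 2 <= B * M.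
Proof.
move=> B0 FB cM.
have M0 : 0 <= M by have := cM 0%N; rewrite big_geq.
have BM0 : 0 <= B * M by rewrite mulr_ge0// ltW.
rewrite -[leRHS]sqr_sqrtr// ler_pXn2r ?nnegrE ?rnorm_ge0 ?sqrtr_ge0//.
apply: cvg_rnorm_le (bessel_series_cvg B0 FB cM); apply: nearW => n.
apply: ler_of_sqr_le; rewrite ?sqrtr_ge0// sqr_sqrtr//.
by rewrite (le_trans (bessel_partial _ _ _ B0 FB))// ler_pM2l.
Qed.

(** * The mixed operator: analysis by one sequence, synthesis by another *)

Section MixedFrameOperator.
Variables (F G : nat -> H) (A B : R).
Hypotheses (A0 : 0 < A) (B0 : 0 < B).
Hypotheses (FA : bessel_bound F A) (GB : bessel_bound G B).

Lemma mixed_operator_cvg x :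
  \sum_(0 <= k < n) dot x (F k) *: G k @[n --> \oo]
    --> synthesis G (analysis dot F x).
Proof. exact: (bessel_series_cvg B0 GB (FA x)). Qed.

Lemma mixed_operator_linear : linear (fun x => synthesis G (analysis dot F x)).
Proof.
apply: linear_limit mixed_operator_cvg => n a x y.
rewrite scaler_sumr -big_split; apply: eq_bigr => k _.
by rewrite /= dotDl dotZl scalerDl scalerA.
Qed.

Lemma rnorm_mixed_operator x :
  rnorm (synthesis G (analysis dot F x)) <= Num.sqrt (B * A) * rnorm x.
Proof.
have BA0 : 0 <= B * A by rewrite mulr_ge0// ltW.
apply: ler_of_sqr_le; first by rewrite mulr_ge0 ?sqrtr_ge0 ?rnorm_ge0.
by rewrite exprMn sqr_sqrtr// -mulrA (rnorm_synthesis B0 GB (FA x)).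
Qed.

End MixedFrameOperator.

(** The finite sums are adjoint term by term, and both sides converge. *)
Lemma mixed_operator_adjoint F G A B x y : 0 < A -> 0 < B ->
  bessel_bound F A -> bessel_bound G B ->
  dot (synthesis G (analysis dot F x)) y = dot x (synthesis F (analysis dot G y)).
Proof.
move=> A0 B0 FA GB.
have Sx := mixed_operator_cvg B0 FA GB (x := x).
have Sy := mixed_operator_cvg A0 GB FA (x := y).
apply: (dot_cvg_adjoint dot_norm Sx Sy) => n.
rewrite dot_suml dot_sumr; apply: eq_bigr => k _.
by rewrite dotZl dotZr -dotC mulrC.
Qed.

End Bessel.

(** * Bounded operators and oblique projections *)

Section BoundedOperators.
Variables (R : realType) (s : scalar_kind).
Variable H : completeNormedModType (scalar R s).
Variable dot : {dot H for @scalar_conj R s}.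
Hypothesis dot_norm : norm_from_dot dot.
Implicit Types (S T : H -> H) (x y : H) (C e : R).

Lemma linear_map0 T : linear T -> T 0 = 0.
Proof. by move=> lT; have := lT (-1) 0 0; rewrite !scaleN1r !addNr. Qed.

Lemma linear_mapD T x y : linear T -> T (x + y) = T x + T y.
Proof. by move=> lT; have := lT 1 x y; rewrite !scale1r. Qed.

Lemma linear_mapZ T a x : linear T -> T (a *: x) = a *: T x.
Proof. by move=> lT; rewrite -[a *: x]addr0 lT linear_map0// addr0. Qed.

Lemma linear_mapB T x y : linear T -> T (x - y) = T x - T y.
Proof. 
by move=> lT; rewrite -(scaleN1r y) linear_mapD// linear_mapZ// scaleN1r. Qed.

Lemma linear_map_sum T I (r : seq I) (P : pred I) (f : I -> H) : linear T ->
  T (\sum_(i <- r | P i) f i) = \sum_(i <- r | P i) T (f i).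
Proof.
move=> lT; apply: (big_morph T) => [x y|]; first exact: linear_mapD.
exact: linear_map0.
Qed.

Lemma linear_iter T n : linear T -> linear (iter n T).
Proof. by move=> lT; elim: n => [|n IH] a x y //=; rewrite IH lT. Qed.

Lemma linear_sum_maps (T : nat -> H -> H) n : (forall k, linear (T k)) ->
  linear (fun x => \sum_(0 <= k < n) T k x).
Proof.
move=> lT a x y; rewrite scaler_sumr -big_split.
by apply: eq_bigr => k _; rewrite lT.
Qed.

Lemma rnorm_iter T e n x : 0 <= e -> (forall y, rnorm (T y) <= e * rnorm y) ->
  rnorm (iter n T x) <= e ^+ n * rnorm x.
Proof.
move=> e0 Te; elim: n => [|n IH] /=; first by rewrite expr0 mul1r.
by rewrite (le_trans (Te _))// exprS -mulrA ler_wpM2l.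
Qed.

Lemma rnorm_sum I (r : seq I) (P : pred I) (f : I -> H) :
  rnorm (\sum_(i <- r | P i) f i) <= \sum_(i <- r | P i) rnorm (f i).
Proof.
apply: (big_ind2 (fun x t => rnorm x <= t)) => [|x t y u xt yu|//].
  by rewrite rnorm0.
by rewrite (le_trans (rnormD _ _))// lerD.
Qed.

Lemma cvg_bounded_linear T C (u : nat -> H) l : linear T ->
  (forall x, rnorm (T x) <= C * rnorm x) ->
  u @ \oo --> l -> (fun n => T (u n)) @ \oo --> T l.
Proof.
move=> lT TC /cvg_rnormP ul; apply/cvg_rnormP => e e0.
have M0 : 0 < Num.max C 1 by rewrite lt_max ltr01 orbT.
have := ul _ (divr_gt0 e0 M0); apply: filterS => n ule.
rewrite -linear_mapB// (le_trans (TC _))//.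
apply: (@le_trans _ _ (Num.max C 1 * rnorm (u n - l))).
  by rewrite ler_wpM2r ?rnorm_ge0// le_max lexx.
by rewrite mulrC -ler_pdivlMr.
Qed.

Lemma opnorm_leP T e : linear T -> 0 <= e ->
  (opnorm T <= e%:E)%E <-> (forall x, rnorm (T x) <= e * rnorm x).
Proof.
move=> lT e0; split=> [Te x|Te].
  have [x0|x0] := eqVneq (rnorm x) 0.
    by rewrite (rnorm_eq0 x0) linear_map0// rnorm0 mulr0.
  have xp : 0 < rnorm x by rewrite lt_neqAle eq_sym x0 rnorm_ge0.
  (* Scaling by [a] puts [x] on the unit sphere, where the supremum applies. *)
  pose a := scalar_of_real s (rnorm x)^-1.
  have na : rnorm a = (rnorm x)^-1.
    rewrite /rnorm ger0_norm ?scalar_of_realK//.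
    by rewrite -(scalar_of_real0 R s) scalar_of_real_le invr_ge0 ltW.
  rewrite -ler_pdivrMr// mulrC -na -rnormZ -linear_mapZ//.
  rewrite -lee_fin; apply: le_trans Te; apply: ereal_sup_ubound.
  exists (a *: x) => //=.
  by rewrite -(scalar_of_real1 R s) ler_rnorm rnormZ na mulVf.
apply: ge_ereal_sup => _ [x /= x1 <-]; rewrite lee_fin (le_trans (Te x))//.
by rewrite ler_piMr// -ler_rnorm scalar_of_real1.
Qed.

Lemma opnorm_ge0 T : (0 <= opnorm T)%E.
Proof.
apply: (@le_trans _ _ (rnorm (T 0))%:E); first by rewrite lee_fin rnorm_ge0.
by apply: ereal_sup_ubound; exists 0 => //=; rewrite normr0.
Qed.

(** A relation between two given maps: every adjoint below is exhibited explicitly. *)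
Definition adjoint_pair S T := forall x y, dot (S x) y = dot x (T y).

Lemma adjoint_pairC S T : adjoint_pair S T -> adjoint_pair T S.
Proof. by move=> ST x y; rewrite dotC -ST -dotC. Qed.

Lemma adjoint_pair_iter S T n : adjoint_pair S T -> adjoint_pair (iter n S) (iter n T).
Proof.
by move=> ST; elim: n => // n IH x y; rewrite iterS ST IH -iterSr.
Qed.

Lemma adjoint_pair_sum (S T : nat -> H -> H) n :
  (forall k, adjoint_pair (S k) (T k)) ->
  adjoint_pair (fun x => \sum_(0 <= k < n) S k x) (fun x => \sum_(0 <= k < n) T k x).
Proof.
by move=> ST x y; rewrite dot_suml dot_sumr; apply: eq_bigr => k _; exact: ST.
Qed.

(** Cancel [|S x|] in [|S x|^2 = <x, T (S x)> <= |x| e |S x|]. *)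
Lemma rnorm_adjoint S T e : 0 <= e -> adjoint_pair S T ->
  (forall x, rnorm (T x) <= e * rnorm x) -> forall x, rnorm (S x) <= e * rnorm x.
Proof.
move=> e0 ST Te x; have [->|x0] := eqVneq (rnorm (S x)) 0.
  by rewrite mulr_ge0 ?rnorm_ge0.
have xp : 0 < rnorm (S x) by rewrite lt_neqAle eq_sym x0 rnorm_ge0.
rewrite -(ler_pM2r xp) -expr2 -(re_dotxx dot_norm) ST.
rewrite (le_trans (re_dot_le dot_norm _ _))//.
by rewrite mulrAC [leRHS]mulrC ler_wpM2l ?rnorm_ge0.
Qed.

End BoundedOperators.

(** * Oblique projections of a direct sum *)

Section ObliqueProjection.
Variables (R : realType) (s : scalar_kind).
Variable H : completeNormedModType (scalar R s).
Variables (A B : set H).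
Hypotheses (lA : linear_subspace A) (lB : linear_subspace B) (AB : direct_sum A B).

Lemma oblique_projP x : A (oblique_proj A B x) /\ B (x - oblique_proj A B x).
Proof.
have [a [b [Aa Bb xab]]] := AB.1 x.
apply: (@xgetPex _ 0 [set a | A a /\ B (x - a)]); exists a.
by split => //; rewrite xab addrC addKr.
Qed.

Lemma oblique_proj_unique x a : A a -> B (x - a) -> oblique_proj A B x = a.
Proof.
move=> Aa Bxa; have [Ap Bp] := oblique_projP x.
apply/eqP; rewrite -subr_eq0; apply/eqP.
suff : (A `&` B) (oblique_proj A B x - a) by rewrite AB.2.
split; first exact: subspaceB.
rewrite (_ : _ - a = (x - a) - (x - oblique_proj A B x)); last first.
  by rewrite opprB [RHS]addrC subrKA.
exact: subspaceB.
Qed.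

Lemma oblique_proj_linear : linear (oblique_proj A B).
Proof.
move=> c x y; have [Ax Bx] := oblique_projP x; have [Ay By] := oblique_projP y.
apply: oblique_proj_unique; first exact: lA.2.
by rewrite opprD addrACA -scalerBr; exact: lB.2.
Qed.

End ObliqueProjection.

(** * Passing from the decomposition along [W] and [V^perp] to the one along [V] and [W^perp] *)

Section ComplementaryPair.
Variables (R : realType) (s : scalar_kind).
Variable H : completeNormedModType (scalar R s).
Variable dot : {dot H for @scalar_conj R s}.
Hypothesis dot_norm : norm_from_dot dot.
Local Notation perp := (orthogonal_complement dot).

Lemma perp_linear (Z : set H) : linear_subspace (perp Z).
Proof.
split=> [w _|a x y Zx Zy w Zw]; first exact: dot0l.
by rewrite dotDl dotZl Zx// Zy// mulr0 addr0.
Qed.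

(** For the projection [z] of [x] on [Z], the vector [x - z] is orthogonal both to [x] and to [z],
    hence to itself. *)
Lemma perp_perp (Z : set H) : linear_subspace Z -> seq_complete Z ->
  perp (perp Z) `<=` Z.
Proof.
move=> lZ cZ x xZ; have [z Zz xz] := orthogonal_decomposition dot_norm lZ cZ x.
suff xz0 : x - z = 0 by rewrite -(subrK z x) xz0 add0r.
apply/rnorm_eq0/eqP; rewrite -sqrf_eq0 -(re_dotxx dot_norm) dotBl xZ//.
by rewrite dotC xz// sub0r scalar_reN scalar_re_conj scalar_re0 oppr0.
Qed.

Variables (W V : set H).
Hypotheses (lW : linear_subspace W) (cW : seq_complete W).
Hypotheses (lV : linear_subspace V) (cV : seq_complete V).
Hypothesis dsum : direct_sum W (perp V).

Local Notation P := (oblique_proj W (perp V)).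

Lemma dot_oblique_projr v x : V v -> dot v (P x) = dot v x.
Proof.
move=> Vv; have [_ xP] := oblique_projP dsum x.
by apply/eqP; rewrite eq_sym -subr_eq0 -dotBr dotC xP// scalar_conj0.
Qed.

(** As [P v] lies in [W] and [u] is orthogonal to [W], [|v|^2 = <v, P v> = <v + u, P v>], which is
    at most [|v + u| C |v|]. *)
Lemma direct_sum_swap_le (C : R) v u : 0 <= C ->
  (forall x, rnorm (P x) <= C * rnorm x) ->
  V v -> perp W u -> rnorm v <= C * rnorm (v + u).
Proof.
move=> C0 PC Vv Wu; have [->|v0] := eqVneq (rnorm v) 0.
  by rewrite mulr_ge0 ?rnorm_ge0.
have vp : 0 < rnorm v by rewrite lt_neqAle eq_sym v0 rnorm_ge0.
rewrite -(ler_pM2r vp) -expr2 -(re_dotxx dot_norm) -(dot_oblique_projr v Vv).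
rewrite -[dot v (P v)]addr0 -(Wu (P v)); last exact: (oblique_projP dsum v).1.
rewrite -dotDl (le_trans (re_dot_le dot_norm _ _))//.
by rewrite mulrAC [leRHS]mulrC ler_wpM2l ?rnorm_ge0.
Qed.

Lemma direct_sum_swap (C : R) : 0 <= C -> (forall x, rnorm (P x) <= C * rnorm x) ->
  direct_sum V (perp W).
Proof.
move=> C0 PC; have lp := perp_linear W.
split; last first.
  apply/seteqP; split=> [v [Vv Wv]|_ ->]; last by split; [exact: lV.1|exact: lp.1].
  apply: rnorm_eq0; apply/eqP; rewrite eq_le rnorm_ge0 andbT.
  (* For [v] in the intersection, the estimate with [u = - v] bounds [|v|] by 0. *)
  have Wv' : perp W (- v) by rewrite -scaleN1r; exact: (subspaceZ lp).
  by rewrite (le_trans (direct_sum_swap_le C0 PC Vv Wv'))// subrr rnorm0 mulr0.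
pose Z : set H := [set x | exists v u, [/\ V v, perp W u & x = v + u]].
have lZ : linear_subspace Z.
  split; first by exists 0, 0; split; [exact: lV.1|exact: lp.1|rewrite addr0].
  move=> a _ _ [v [u [Vv Wu ->]]] [v' [u' [Vv' Wu' ->]]].
  exists (a *: v + v'), (a *: u + u'); split; [exact: lV.2|exact: lp.2|].
  by rewrite scalerDr addrACA.
(* The estimate makes the [V]-components of a Cauchy sequence Cauchy; the [W^perp]-components
   converge as differences, and [W^perp] is closed under limits. *)
have cZ : seq_complete Z.
  move=> z Zz zc.
  have [v vP] := choice Zz; have [u uP] := choice vP.
  have Vv n : V (v n) by case: (uP n).
  have Wu n : perp W (u n) by case: (uP n).
  have zE n : z n = v n + u n by case: (uP n).
  have vc : rcauchy v.
    move=> e e0; have C1 : 0 < C + 1 by rewrite ltr_wpDl.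
    have [N hN] := zc _ (divr_gt0 e0 C1); exists N => m n Nm Nn.
    have := direct_sum_swap_le C0 PC (subspaceB lV (Vv m) (Vv n))
      (subspaceB lp (Wu m) (Wu n)).
    rewrite addrACA -opprD -!zE => /le_trans; apply.
    rewrite (@le_trans _ _ ((C + 1) * rnorm (z m - z n)))//.
      by rewrite ler_wpM2r ?rnorm_ge0// lerDl.
    by rewrite mulrC -ler_pdivlMr//; exact: hN.
  have [v' Vv' vv'] := cV Vv vc.
  have zz' := rcauchy_cvg zc.
  have uE : u = fun n => z n - v n by apply/funext => n; rewrite zE addrC addKr.
  have uu' : u @ \oo --> limn z - v' by rewrite uE; apply: cvgB.
  exists (limn z) => //; exists v', (limn z - v'); split=> //.
    by move=> w Ww; apply: (dot_seq_cvgl dot_norm uu') => n; exact: Wu.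
  by rewrite addrC subrK.
move=> x; have [z [v [u [Vv Wu zE]]] xz] := orthogonal_decomposition dot_norm lZ cZ x.
exists v, u; split=> //; rewrite -zE; apply/eqP; rewrite -subr_eq0; apply/eqP.
(* The remainder [x - z] is orthogonal to [W^perp] and to [V], both contained in [Z]. *)
suff : (W `&` perp V) (x - z) by rewrite dsum.2.
split.
  apply: (perp_perp lW cW) => w Ww; apply: xz.
  by exists 0, w; split=> //; [exact: lV.1|rewrite add0r].
move=> w Vw; apply: xz.
by exists w, 0; split=> //; [exact: lp.1|rewrite addr0].
Qed.

End ComplementaryPair.

(** * Dual defects *)

Section DualDefect.
Variables (R : realType) (s : scalar_kind).
Variable H : completeNormedModType (scalar R s).
Variable dot : {dot H for @scalar_conj R s}.
Hypothesis dot_norm : norm_from_dot dot.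
Local Notation perp := (orthogonal_complement dot).
Variables (W V : set H) (lW : linear_subspace W).
Hypothesis WV : direct_sum W (perp V).
Implicit Types (F G : nat -> H) (A B e : R).

Lemma dual_defect_linear F G A B : 0 < B -> bessel_bound dot F B ->
  bessel_bound dot G A -> linear (dual_defect dot W V F G).
Proof.
move=> B0 FB GA a x y; rewrite /dual_defect.
rewrite (oblique_proj_linear lW (perp_linear dot V) WV).
rewrite (mixed_operator_linear dot_norm B0 GA FB).
by rewrite scalerBr opprD addrACA.
Qed.

(** The projection is the defect plus the mixed operator; this supplies the constant that
    [direct_sum_swap] asks for. *)
Lemma oblique_proj_bounded F G A B e : 0 < A -> 0 < B -> bessel_bound dot F B ->
  bessel_bound dot G A ->
  (forall x, rnorm (dual_defect dot W V F G x) <= e * rnorm x) ->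
  forall x, rnorm (oblique_proj W (perp V) x)
            <= (e + Num.sqrt (B * A)) * rnorm x.
Proof.
move=> A0 B0 FB GA De x.
rewrite -(subrK (synthesis F (analysis dot G x)) (oblique_proj _ _ x)).
rewrite (le_trans (rnormD _ _))// mulrDl lerD//; first exact: De.
exact: (rnorm_mixed_operator dot_norm A0 B0 GA FB).
Qed.

Hypothesis VW : direct_sum V (perp W).

(** Both sides equal the inner product of the two projected vectors, since each projection error is
    orthogonal to the range of the other projection. *)
Lemma oblique_proj_adjoint x y :
  dot (oblique_proj V (perp W) x) y = dot x (oblique_proj W (perp V) y).
Proof.
have [Vx Wx] := oblique_projP VW x; have [Wy Vy] := oblique_projP WV y.
rewrite -(dot_oblique_projr WV y Vx); apply/esym/eqP.
by rewrite -subr_eq0 -dotBl Wx.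
Qed.

Lemma dual_defect_adjoint F G A B : 0 < A -> 0 < B ->
  bessel_bound dot F B -> bessel_bound dot G A ->
  adjoint_pair dot (dual_defect dot V W G F) (dual_defect dot W V F G).
Proof.
move=> A0 B0 FB GA x y; rewrite dotBl dotBr oblique_proj_adjoint.
by rewrite (mixed_operator_adjoint dot_norm _ _ B0 A0 FB GA).
Qed.

(* On [V] the projection onto [W] satisfies [<x, P x> = |x|^2], so a defect of
   norm [< 1] keeps [<x, T_F T_G^* x>], hence the analysis coefficients of [x],
   bounded below. *)
Lemma frame_of_dual_defect F G A B e : 0 < A -> 0 < B -> e < 1 ->
  bessel_bound dot F B -> bessel_bound dot G A -> (forall k, V (G k)) ->
  (forall x, rnorm (dual_defect dot W V F G x) <= e * rnorm x) ->
  frame dot V G.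
Proof.
move=> A0 B0 e1 FB GA GV De; split.
  by split => //; exists A => x _; apply/coef_energy_leP => n; exact: GA.
have e1' : 0 < 1 - e by rewrite subr_gt0.
(* This constant combines [(1 - e) |x| <= |S|] with [|S|^2 <= B M], where [S] is the mixed operator
   at [x] and [M] any bound on the partial energies. *)
exists ((1 - e) ^+ 2 / B); first by rewrite divr_gt0// exprn_gt0.
move=> x Vx; apply: le_coef_energy => M xM.
have M0 : 0 <= M by have := xM 0%N; rewrite big_geq.
rewrite mulrAC ler_pdivrMr// [leRHS]mulrC -exprMn.
rewrite (le_trans _ (rnorm_synthesis dot_norm B0 FB xM))//.
rewrite ler_pXn2r ?nnegrE ?rnorm_ge0//; last by rewrite mulr_ge0 ?rnorm_ge0// ltW.
set S := synthesis F _.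
have [->|x0] := eqVneq (rnorm x) 0; first by rewrite mulr0 rnorm_ge0.
have xp : 0 < rnorm x by rewrite lt_neqAle eq_sym x0 rnorm_ge0.
rewrite -(ler_pM2l xp).
(* Splitting the projection of [x] into defect and [S] gives [|x|^2 <= e |x|^2 + |x| |S|]. *)
have xS := re_dot_le dot_norm x S.
have xD := re_dot_le dot_norm x (dual_defect dot W V F G x).
have := re_dotxx dot_norm x; rewrite -(dot_oblique_projr WV x Vx).
rewrite -(subrK S (oblique_proj _ _ x)) dotDr scalar_reD.
rewrite -/(dual_defect dot W V F G x) => xE.
have := De x; rewrite -(ler_pM2l xp); nra.
Qed.

End DualDefect.

(** * The iterated dual family and its defect *)

Section IteratedDual.
Variables (R : realType) (s : scalar_kind).
Variable H : completeNormedModType (scalar R s).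
Variable dot : {dot H for @scalar_conj R s}.
Hypothesis dot_norm : norm_from_dot dot.
Local Notation perp := (orthogonal_complement dot).
Variables (W V : set H) (lV : linear_subspace V) (cV : closed V).
Hypotheses (WV : direct_sum W (perp V)) (VW : direct_sum V (perp W)).
Variables (F G : nat -> H) (A B e : R).
Hypotheses (A0 : 0 < A) (B0 : 0 < B) (e0 : 0 <= e).
Hypotheses (FW : forall k, W (F k)) (GV : forall k, V (G k)).
Hypotheses (FB : bessel_bound dot F B) (GA : bessel_bound dot G A).
Hypothesis FG : forall x, rnorm (dual_defect dot W V F G x) <= e * rnorm x.

Local Notation D := (dual_defect dot V W G F).
Local Notation D' := (dual_defect dot W V F G).

Let lD : linear D.
Proof. exact: (dual_defect_linear dot_norm lV VW A0 GA FB). Qed.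

Let DD' : adjoint_pair dot D D'.
Proof. exact: (dual_defect_adjoint dot_norm WV VW A0 B0 FB GA). Qed.

Let De x : rnorm (D x) <= e * rnorm x.
Proof. exact: (rnorm_adjoint dot_norm e0 DD' FG). Qed.

Lemma synthesis_in x : V (synthesis G (analysis dot F x)).
Proof.
have Sx := mixed_operator_cvg dot_norm A0 FB GA (x := x).
apply: (closed_cvg V) Sx => //; apply: nearW => n.
by apply: subspace_sum => // k _; exact: subspaceZ.
Qed.

Lemma iterated_dual_in N k : V (iterated_dual dot V W F G N k).
Proof.
apply: (subspace_sum lV) => n _; elim: n => //= n Vn.
apply: (subspaceB lV); first exact: (oblique_projP VW _).1.
exact: synthesis_in.
Qed.

(** The iterated family is the image of [G] under [1 + D + ... + D^N], which is bounded and linear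
    and so commutes with the limit defining the synthesis. *)
Lemma synthesis_iterated_dual N x :
  synthesis (iterated_dual dot V W F G N) (analysis dot F x) =
  \sum_(0 <= n < N.+1) iter n D (synthesis G (analysis dot F x)).
Proof.
have Sx := mixed_operator_cvg dot_norm A0 FB GA (x := x).
pose T y := \sum_(0 <= n < N.+1) iter n D y.
have lT : linear T by apply: linear_sum_maps => n; exact: linear_iter.
have Tb y : rnorm (T y) <= (\sum_(0 <= n < N.+1) e ^+ n) * rnorm y.
  rewrite (le_trans (rnorm_sum _ _ _))// mulr_suml ler_sum// => n _.
  exact: rnorm_iter.
apply: (cvg_lim (@norm_hausdorff _ H)).
apply: cvg_trans (cvg_bounded_linear lT Tb Sx).
rewrite (_ : series _ = fun n => T (\sum_(0 <= k < n) dot x (F k) *: G k)) //.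
apply/funext => n; rewrite linear_map_sum//; apply: eq_bigr => k _.
by rewrite linear_mapZ.
Qed.

Let D_proj x : D (oblique_proj V (perp W) x) = D x.
Proof.
have [Vx Wx] := oblique_projP VW x.
suff D0 : D (x - oblique_proj V (perp W) x) = 0.
  by apply/eqP; rewrite eq_sym -subr_eq0 -linear_mapB// D0.
set u := x - _ in Wx *; rewrite /dual_defect.
rewrite (oblique_proj_unique lV (perp_linear dot W) VW lV.1) ?subr0//.
rewrite sub0r; apply/eqP; rewrite oppr_eq0; apply/eqP/rnorm_eq0/eqP.
(* All coefficients of [u] against [F] vanish, so 0 bounds their energy and the synthesis estimate
   reads [A * 0]. *)
rewrite -sqrf_eq0 eq_le sqr_ge0 andbT -(mulr0 A).
apply: (rnorm_synthesis dot_norm A0 GA) => n.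
by rewrite big1// => k _; rewrite /analysis Wx// rnorm0 expr0n.
Qed.

Lemma iterated_dual_defect N x :
  dual_defect dot V W (iterated_dual dot V W F G N) F x = iter N.+1 D x.
Proof.
rewrite /dual_defect synthesis_iterated_dual.
have -> : synthesis G (analysis dot F x) = oblique_proj V (perp W) x - D x.
  by rewrite /dual_defect subKr.
set Q := oblique_proj _ _ _.
suff -> : \sum_(0 <= n < N.+1) iter n D (Q - D x) = Q - iter N.+1 D x.
  by rewrite subKr.
(* The term added at each stage is [D^(N+1) Q - D^(N+2) x], and [D_proj] turns [D^(N+1) Q] into
   [D^(N+1) x], which cancels. *)
elim: N => [|N IH]; first by rewrite big_nat1.
rewrite big_nat_recr// IH [iter N.+1 D (_ - _)]linear_mapB; last exact: linear_iter.
have -> : iter N.+1 D Q = iter N.+1 D x by rewrite !iterSr D_proj.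
by rewrite -iterSr; exact: subrKA.
Qed.

(** Pairing [x] with the iterated family amounts to pairing [T' x] with [G], where [T'] is the
    adjoint sum of powers of [D'], of norm at most [b]; hence the bound [A b^2]. *)
Lemma iterated_dual_bessel N :
  exists2 C, 0 < C & bessel_bound dot (iterated_dual dot V W F G N) C.
Proof.
pose T' y := \sum_(0 <= n < N.+1) iter n D' y.
pose b := \sum_(0 <= n < N.+1) e ^+ n.
have b0 : 0 < b.
  by rewrite /b big_nat_recl// expr0 ltr_wpDr ?ltr01// sumr_ge0// => *; exact: exprn_ge0.
have T'b y : rnorm (T' y) <= b * rnorm y.
  rewrite (le_trans (rnorm_sum _ _ _))// mulr_suml ler_sum// => n _.
  exact: rnorm_iter.
exists (A * b ^+ 2) => [|x n]; first by rewrite mulr_gt0// exprn_gt0.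
rewrite (eq_bigr (fun k => rnorm (dot (T' x) (G k) : scalar R s) ^+ 2)); last first.
  move=> k _; rewrite rnorm_dotC.
  rewrite (adjoint_pair_sum N.+1 (fun n => adjoint_pair_iter n DD')).
  by rewrite rnorm_dotC.
rewrite (le_trans (GA _ _))// -mulrA ler_wpM2l ?(ltW A0)// -exprMn.
by rewrite ler_pXn2r ?nnegrE ?rnorm_ge0 ?mulr_ge0 ?rnorm_ge0 ?(ltW b0).
Qed.

Lemma iterated_dual_defect_le N x :
  rnorm (dual_defect dot V W (iterated_dual dot V W F G N) F x)
    <= e ^+ N.+1 * rnorm x.
Proof. by rewrite iterated_dual_defect; exact: rnorm_iter. Qed.

(** [approx_oblique_dual] measures the defect on the [W] side, whereas the telescoping computes its
    adjoint on the [V] side. *)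
Lemma iterated_dual_defect_adjoint_le N x :
  rnorm (dual_defect dot W V F (iterated_dual dot V W F G N) x)
    <= e ^+ N.+1 * rnorm x.
Proof.
have [C C0 GC] := iterated_dual_bessel N.
have adj := dual_defect_adjoint dot_norm WV VW C0 B0 FB GC.
apply: (rnorm_adjoint dot_norm _ (adjoint_pairC adj)); first exact: exprn_ge0.
exact: iterated_dual_defect_le.
Qed.

End IteratedDual.

Theorem proposition5p1 (R : realType) (s : scalar_kind)
    (H : completeNormedModType (scalar R s)) (dot : {dot H for @scalar_conj R s})
    (dot_norm : norm_from_dot dot) (sepH : separable H)
    (W V : set H)
    (closedW : closed_linear_subspace W) (closedV : closed_linear_subspace V)
    (dsum : direct_sum W (orthogonal_complement dot V))
    (F G : nat -> H) (eps : R) (eps_ge0 : 0 <= eps) (eps_lt1 : eps < 1)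
    (FG : approx_oblique_dual dot eps W V F G) :
  (forall N : nat,
     approx_oblique_dual dot (eps ^+ N.+1) W V F (iterated_dual dot V W F G N)) /\
  opnorm (dual_defect dot V W (iterated_dual dot V W F G N) F) @[N --> \oo]
    --> 0%E.
Proof.
have [frameF [besselG _] FGeps] := FG.
have [W0 lW cW] := closedW; have [V0 lV cV] := closedV.
have {W0}lW : linear_subspace W by split.
have {V0}lV : linear_subspace V by split.
have [FW _] := frameF.1; have [GV _] := besselG.
have [B B0 FB] := bessel_seq_bound dot_norm closedW frameF.1.
have [A A0 GA] := bessel_seq_bound dot_norm closedV besselG.
have lFG := dual_defect_linear dot_norm lW dsum B0 FB GA.
have {}FGeps := (opnorm_leP lFG eps_ge0).1 FGeps.
have Pb := oblique_proj_bounded dot_norm A0 B0 FB GA FGeps.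
have C0 : 0 <= eps + Num.sqrt (B * A) by rewrite addr_ge0 ?sqrtr_ge0.
(* Only from here on is [oblique_proj V (orthogonal_complement dot W)] known to be a genuine
   projection rather than a default value of [xget]. *)
have VW := direct_sum_swap dot_norm lW (closed_seq_complete cW) lV
  (closed_seq_complete cV) dsum C0 Pb.
have Gb := iterated_dual_bessel dot_norm dsum VW A0 B0 eps_ge0 FB GA FGeps.
split=> [N|].
  have [C C0' GC] := Gb N.
  have le_eps := iterated_dual_defect_adjoint_le dot_norm lV dsum VW A0 B0
    eps_ge0 FW FB GA FGeps N.
  split=> //; last first.
    apply/opnorm_leP => //; last exact: exprn_ge0.
    exact: (dual_defect_linear dot_norm lW dsum B0 FB GC).
  (* The lower frame bound of the iterated family follows from its own defect bound, as
     [eps^(N+1) < 1]. *)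
  apply: (frame_of_dual_defect dot_norm dsum C0' B0 _ FB GC _ le_eps).
    by rewrite exprn_ilt1.
  exact: (iterated_dual_in dot_norm lV cV VW A0 GV FB GA).
have le_eps N : (opnorm (dual_defect dot V W (iterated_dual dot V W F G N) F)
                 <= (eps ^+ N.+1)%:E)%E.
  have [C C0' GC] := Gb N.
  apply/opnorm_leP; last 1 first.
  - exact: (iterated_dual_defect_le dot_norm lV dsum VW A0 B0 eps_ge0 FW FB GA FGeps).
  - exact: (dual_defect_linear dot_norm lV VW C0' GC FB).
  - exact: exprn_ge0.
(* The norms lie between 0 and the geometric sequence [eps^(N+1)]; the shifted exponent is removed
   at the end. *)
apply: (@squeeze_cvge _ _ _ _ (fun=> 0%E) _ (fun N => (eps ^+ N.+1)%:E)).
- by apply: nearW => N; rewrite opnorm_ge0 le_eps.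
- exact: cvg_cst.
- apply: cvg_EFin; first exact: nearW.
  suff : (fun N => eps ^+ N.+1) @ \oo --> (0 : R) by [].
  by rewrite (cvg_shiftS (fun N => eps ^+ N)); apply: cvg_expr; rewrite ger0_norm.
Qed.
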